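(* Let $G$ be a solvable group on which a nilpotent group $A$ acts (by automorphisms) with regular orbits. Suppose that the action of $A$ on $G$ is good. Let $V$ be a complex $GA$-module such that $V_G$ is homogeneous, $C_V(A)=0$, but $C_V(A_0)\neq 0$ for every proper subgroup $A_0$ of $A$. Let $N\leq G$ be a normal subgroup of $GA$ such that $[Z(N),A]$ acts nontrivially on $V$, and let $W$ be a homogeneous component of $V_N$. Then $W$ is $A$-invariant and $[G,A]\leq N_G(W)$, that is, $G=N_G(W)C_G(A)$.
   Context: All groups are finite, and modules are finite-dimensional. $GA$ denotes the semidirect product $G\rtimes A$. For a subgroup $X$ of $GA$, $V_X$ denotes the restriction of $V$ to $X$; $V_X$ is homogeneous if it is a direct sum of isomorphic irreducible $X$-modules, and a homogeneous component of $V_X$ is the sum of all irreducible submodules isomorphic to a given one. $N_G(W)$ is the stabilizer of the subspace $W$ in $G$, $C_V(X)$ is the subspace of vectors fixed by $X$, and $Z(N)$ is the center of $N$. Good action: the action of $A$ on $G$ by automorphisms is called good if $H=[H,B]C_H(B)$ for every subgroup $B$ of $A$ and every $B$-invariant subgroup $H$ of $G$. Here $[H,B]$ is the subgroup generated by all $h^{-1}h^b$ with $h\in H$, $b\in B$, and $C_H(B)$ is the subgroup of elements of $H$ fixed by $B$. Regular orbits: a group $B$ acting on a group $G$ is said to act with regular orbits on $G$ if for any $B$-invariant section $S$ of $G$ on which $B$ acts irreducibly there exists $x\in S$ such that $C_B(x)=C_B(S)$, where $C_B(S)$ is the kernel of the action of $B$ on $S$. *)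

(* Defs.v *)
From mathcomp Require Import all_boot all_order all_algebra.
From mathcomp Require Import all_fingroup all_solvable all_character.
From mathcomp Require Import reals complex.

Set Implicit Arguments.
Unset Strict Implicit.
Unset Printing Implicit Defensive.

Import GroupScope.

(* Actions by automorphisms are internal: both groups lie in one ambient      *)
(* finGroupType and the acting group normalises the other and acts on it by   *)
(* conjugation. The acting group need not act faithfully.                     *)

Section Actions.

Variable gT : finGroupType.
Implicit Types A B G H K GA : {group gT}.

Definition good_action A G : Prop :=
  forall B H, B \subset A -> H \subset G -> B \subset 'N(H) ->
  [~: H, B] * 'C_H(B) = H.

(* The B-invariant sections of G are the H / K below; 'Q is the conjugation   *)
(* action on cosets of K, with domain 'N(K).                                  *)
Definition acts_with_regular_orbits B G : Prop :=
  forall H K, H \subset G -> K <| H -> B \subset 'N(H) -> B \subset 'N(K) ->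
  acts_irreducibly B (H / K) 'Q ->
  exists2 x, x \in H / K & 'C_B[x | 'Q] = 'C_B(H / K | 'Q).

Lemma sdprod_subl G A GA : G ><| A = GA -> G \subset GA.
Proof. by case/sdprod_context=> /normal_sub. Qed.

End Actions.

Section Modules.

Variables (F : fieldType) (gT : finGroupType) (X : {group gT}) (n : nat).
Variable rX : mx_representation F X n.

(* mxsemisimple rX 1%:M, with the simple summands pairwise isomorphic.        *)
Definition homogeneous_repr : Prop :=
  exists (I : finType) (U : I -> 'M[F]_n) (W := (\sum_i U i)%MS),
    [/\ forall i, mxsimple rX (U i),
        forall i j, mx_iso rX (U i) (U j),
        (W :=: (1%:M)%R)%MS & mxdirect W].

Definition homogeneous_component (W : 'M[F]_n) : Prop :=
  exists2 M : 'M[F]_n, mxsimple rX M & (W :=: component_mx rX M)%MS.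

End Modules.

(* Main.v *)
(* Clifford theory turns V into a system of imprimitivity: G permutes the     *)
(* homogeneous components of V_N transitively, as V_G is homogeneous, and it  *)
(* suffices that A fixes all of them, for then so does [G, A].                *)
(*   Let D be a block with stabiliser B in A whose A-translates outside B are *)
(* disjoint from D. A nonzero B-fixed vector in V_D would induce a nonzero    *)
(* A-fixed vector, so C_{V_D}(B) = 0; if moreover the C_G(B)-translates of D  *)
(* cover all components then C_V(B) = 0, whence B = A by minimality of A.     *)
(*   Now shrink an A-invariant subgroup X of G having an A-invariant orbit    *)
(* whose C_G(A)-translates cover all components, until X = 1. Let Y be a      *)
(* maximal proper A-invariant subgroup containing X'. Either Y has the same  *)
(* orbit, or X / Y acts regularly on the Y-blocks of this orbit. In the       *)
(* latter case some block is stabilised in A by a subgroup B with             *)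
(* [X, B] <= Y: either A centralises X / Y, or A fixes a block because the    *)
(* complements to X / Y are conjugate, and the regular orbit of A on X / Y    *)
(* supplies the required block. As X = [X, B] C_X(B), the previous paragraph  *)
(* gives B = A, and Y can replace X.                                          *)

Require Import Defs.
From mathcomp Require Import all_boot all_order all_algebra.
From mathcomp Require Import all_fingroup all_solvable all_character.
From mathcomp Require Import reals complex.

Set Implicit Arguments.
Unset Strict Implicit.
Unset Printing Implicit Defensive.

Import GroupScope.

(** The argument separates linear algebra from permutations. [Clifford_orbit_homogeneous] makes [G]
    transitive on the components of [V_N]. Fixed points enter through one rule: if [B] stabilises a
    [Y]-orbit of components in [A], and the [C_G(B)]-translates of this orbit cover all components,
    then [block_rfix0] and [rfix0_of_block] give [C_V(B) = 0], so [B = A]. Granted this rule,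
    [astab_of_block_kernels] is a descent on permutations; its critical step is
    [exists_block_kernel], which rests on [minnormal_complement_conj]. *)

(** * Fixed vectors in a system of imprimitivity *)

Section Imprimitivity.

Import GRing.Theory.
Local Open Scope ring_scope.

Variables (F : fieldType) (gT : finGroupType) (G : {group gT}) (n : nat).
Variable rG : mx_representation F G n.
Variables (T : finType) (to : action G T) (E : T -> 'M[F]_n).
Hypothesis sumE : (\sum_t E t :=: 1%:M)%MS.
Hypothesis dxE : mxdirect (\sum_t E t).
Hypothesis actE : forall t x, x \in G -> (E (to t x) :=: E t *m rG x)%MS.

(* Locked, as associativity rewriting would otherwise expose the product of   *)
(* matrices that defines proj_mx.                                             *)
Definition imprim_proj t : 'M_n :=
  locked (proj_mx (E t) (\sum_(s | s != t) E s)%MS).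

Local Notation P := imprim_proj.

Lemma imprim_tiE t : (E t :&: \sum_(s | s != t) E s = 0)%MS.
Proof. exact: (mxdirect_sumsP dxE). Qed.

Lemma mul_imprim_proj m (U : 'M_(m, n)) s t :
  (U <= E s)%MS -> U *m P t = if s == t then U else 0.
Proof.
rewrite /imprim_proj -lock; case: eqVneq => [-> | nest] sUE.
  exact: proj_mx_id (imprim_tiE t) sUE.
by rewrite (proj_mx_0 (imprim_tiE t)) ?(submx_trans sUE) // (sumsmx_sup s).
Qed.

Lemma imprim_eq (X Y : 'M_n) : (forall s, E s *m X = E s *m Y) -> X = Y.
Proof.
move=> eqXY.
have /sub_sumsmxP[u def1] : (1%:M <= \sum_t E t)%MS by rewrite sumE.
rewrite -[X]mul1mx -[Y]mul1mx def1 !mulmx_suml.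
by apply: eq_bigr => s _; rewrite -!mulmxA eqXY.
Qed.

Lemma sum_imprim_proj : \sum_t P t = 1%:M.
Proof.
apply: imprim_eq => s; rewrite mulmx_sumr mulmx1 (bigD1 s) //= big1 => [|t nest].
  by rewrite (mul_imprim_proj _ (submx_refl (E s))) eqxx addr0.
by rewrite (mul_imprim_proj t (submx_refl (E s))) eq_sym (negPf nest).
Qed.

Lemma imprim_projM s t : P s *m P t = if s == t then P s else 0.
Proof.
rewrite (mul_imprim_proj _ (_ : (_ <= E s)%MS)) //.
by rewrite -[P s]mul1mx /imprim_proj -lock proj_mx_sub.
Qed.

Lemma imprim_projJ t x : x \in G -> rG x *m P (to t x) = P t *m rG x.
Proof.
move=> Gx; apply: imprim_eq => s.
rewrite !mulmxA (mul_imprim_proj t (submx_refl (E s))).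
rewrite (mul_imprim_proj (to t x) (_ : (_ <= E (to s x))%MS)) ?actE //.
by rewrite (can_eq (actKin to Gx)); case: eqP => // _; rewrite mul0mx.
Qed.

Definition block_proj (S : {set T}) := \sum_(t in S) P t.

Lemma block_projJ S x :
  x \in G -> rG x *m block_proj (to^* S x)%act = block_proj S *m rG x.
Proof.
move=> Gx; rewrite mulmx_sumr mulmx_suml big_imset /=; last first.
  by move=> s t _ _; apply: (can_inj (actKin to Gx)).
by apply: eq_bigr => t _; apply: imprim_projJ.
Qed.

Lemma block_proj_id S : block_proj S *m block_proj S = block_proj S.
Proof.
rewrite mulmx_suml; apply: eq_bigr => t St.
rewrite mulmx_sumr (bigD1 t) //= imprim_projM eqxx.
rewrite big1 ?addr0 // => s /andP[_ nest].
by rewrite imprim_projM eq_sym (negPf nest).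
Qed.

Lemma block_proj_disjoint (S S' : {set T}) :
  [disjoint S & S'] -> block_proj S *m block_proj S' = 0.
Proof.
move=> tiS; rewrite mulmx_suml big1 // => t St.
rewrite mulmx_sumr big1 // => s S's.
rewrite imprim_projM; case: eqP => // Dt.
by rewrite -Dt (disjointFr tiS St) in S's.
Qed.

(* The sum of the A-translates of a B-fixed vector u of the block S is fixed  *)
(* by A, and its component in S is #|B| times u.                              *)
Lemma block_rfix0 (A B : {group gT}) (S : {set T}) :
    [pchar F]^'.-group B -> A \subset G -> B \subset A ->
    {in B, forall b, to^* S b = S}%act ->
    {in A, forall a, a \notin B -> [disjoint S & to^* S a]}%act ->
  rfix_mx rG A = 0 -> rfix_mx rG B *m block_proj S = 0.
Proof.
move=> F'B sAG sBA fixS tiS fixA0; have sBG := subset_trans sBA sAG.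
set u := rfix_mx rG B *m block_proj S.
have u_id: u *m block_proj S = u by rewrite -mulmxA block_proj_id.
have uB b: b \in B -> u *m rG b = u.
  move=> Bb; rewrite -mulmxA -block_projJ ?(subsetP sBG) // fixS //.
  by rewrite mulmxA rfix_mx_id.
have w0: \sum_(a in A) u *m rG a = 0.
  apply/eqP; rewrite -submx0 -[X in (_ <= X)%MS]fixA0; apply/rfix_mxP=> x Ax.
  rewrite mulmx_suml [RHS](reindex_acts 'R _ Ax) ?astabsR //=.
  apply: eq_bigr => a Aa; rewrite -mulmxA -repr_mxM ?(subsetP sAG) //.
have:= congr1 (mulmx^~ (block_proj S)) w0; rewrite mul0mx mulmx_suml.
rewrite (big_setID B) /= (setIidPr sBA) [X in _ + X]big1 => [|a /setDP[Aa nBa]].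
  rewrite addr0 (eq_bigr (fun _ => u)) => [|b Bb]; last by rewrite uB.
  rewrite sumr_const -scaler_nat => /eqP; rewrite scaler_eq0.
  by rewrite /pgroup pcharf'_nat in F'B; rewrite (negPf F'B) => /eqP.
have Ga := subsetP sAG a Aa.
rewrite -{1}u_id -(mulmxA u) -block_projJ // -!mulmxA.
by rewrite block_proj_disjoint ?mulmx0 // disjoint_sym tiS.
Qed.

(** An element of ['C_G(B)] preserves the fixed space of [B], so the vanishing of its projection on
    [S] passes to every translate of [S], hence to every component. *)
Lemma rfix0_of_block (B : {group gT}) (S : {set T}) :
    B \subset G -> rfix_mx rG B *m block_proj S = 0 ->
    (forall t, exists2 c, c \in 'C_G(B) & t \in to^* S c)%act ->
  rfix_mx rG B = 0.
Proof.
move=> sBG fixS0 coverS.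
rewrite -[LHS]mulmx1 -sum_imprim_proj mulmx_sumr big1 // => t _.
have [c cBc St] := coverS t; have [Gc cc] := setIP cBc.
have ->: P t = block_proj (to^* S c)%act *m P t.
  rewrite mulmx_suml (bigD1 t) //= imprim_projM eqxx.
  rewrite big1 ?addr0 // => s /andP[_ nest].
  by rewrite imprim_projM (negPf nest).
suffices fixSc0: rfix_mx rG B *m block_proj (to^* S c)%act = 0.
  by rewrite mulmxA fixSc0 mul0mx.
have: (rfix_mx rG B *m rG c^-1%g <= rfix_mx rG B)%MS.
  rewrite -rfix_mx_conjsg ?groupV // (normP _) //.
  by rewrite (subsetP (cent_sub _)) ?groupV.
case/submxP=> Z DZ; rewrite -(repr_mxKV rG Gc (rfix_mx rG B)) DZ.
by rewrite -[LHS]mulmxA block_projJ // mulmxA -(mulmxA Z) fixS0 mulmx0 mul0mx.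
Qed.

End Imprimitivity.

(** * Conjugacy of complements to a minimal normal subgroup *)

Section Complements.

Variable gT : finGroupType.
Implicit Types M A L : {group gT}.

(* The p'-core of A is a Hall p'-subgroup of MA with normaliser A, and every  *)
(* complement is nilpotent with a p'-core conjugate to that of A.             *)
Lemma minnormal_complement_conj M A L :
    minnormal M A -> solvable M -> nilpotent A -> ~~ (A \subset 'C(M)) ->
    M :&: A = 1 -> M :&: L = 1 -> M * A = M * L ->
  exists2 x, x \in M & A :=: L :^ x.
Proof.
move=> minM solM nilA ncMA tiMA tiML eqMAL.
have [nMA ntM abM] := minnormal_solvable minM (subxx M) solM.
have [p p_pr /andP[pM _]] := is_abelemP abM.
have minP := (mingroupP minM).2.
have nML: L \subset 'N(M).
  apply: subset_trans (mulG_subr M L) _.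
  by rewrite -eqMAL mul_subG ?normG.
have oAL: #|A| = #|L|.
  have:= TI_cardMg tiMA; rewrite eqMAL (TI_cardMg tiML) => /eqP.
  by rewrite eqn_pmul2l // => /eqP.
have nilL: nilpotent L.
  have isoL: L \isog L / M by apply: quotient_isog.
  have isoA: A \isog A / M by apply: quotient_isog.
  rewrite (isog_nil isoL) /= -(quotientMidl M L) -eqMAL quotientMidl.
  by rewrite -(isog_nil isoA).
pose Q := (M <*> A)%G; have defQ: Q :=: M * A by rewrite /= norm_joinEr.
have sAQ: A \subset Q by rewrite joing_subr.
have sLQ: L \subset Q by rewrite defQ eqMAL mulG_subr.
have solQ: solvable Q.
  rewrite (series_sol (_ : M <| Q)); last first.
    by rewrite /normal joing_subl join_subG normG.
  by rewrite solM /= quotientYidl // quotient_sol ?nilpotent_sol.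
have hallQ (K : {group gT}) : K \subset Q -> nilpotent K -> #|K| = #|A| ->
  p^'.-Hall(Q) 'O_p^'(K).
- move=> sKQ nilK oK; have hallK := nilpotent_pcore_Hall p^' nilK.
  rewrite pHallE (subset_trans (pcore_sub _ _) sKQ) (card_Hall hallK) oK.
  rewrite defQ (TI_cardMg tiMA) partnM //.
  have p'M: p^'^'.-nat #|M| by rewrite pnatNK.
  by rewrite (part_p'nat p'M) mul1n eqxx.
have [y Qy defAp] := Hall_trans solQ (hallQ A sAQ nilA erefl)
                               (hallQ L sLQ nilL (esym oAL)).
(* The factor of [y] in [L] normalises the core of [L], so the conjugating element can be taken in
   [M]. *)
move: Qy; rewrite defQ eqMAL -(normC nML) => /mulsgP[l m Ll Mm Dy].
have {}defAp: 'O_p^'(A) = 'O_p^'(L) :^ m.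
  by rewrite defAp Dy conjsgM (normsP (gFnorm _ L)).
pose N := 'N_Q('O_p^'(A)).
have sAN: A \subset N by rewrite subsetI sAQ gFnorm.
have sLmN: L :^ m \subset N.
  rewrite subsetI defAp normJ conjSg gFnorm andbT.
  by rewrite conj_subG // (subsetP (joing_subl M A)).
(* The [p]-core of [A] centralises the irreducible [p]-group [M]; if the [p']-core did too, so would
   [A], their product. *)
have cMN: 'C_M('O_p^'(A)) = M -> False.
  move/setIidPl=> cMA; case/negP: ncMA.
  have irrA: acts_irreducibly A M 'J.
    apply/mingroupP; rewrite ntM /= astabsJ; split=> // K /andP[ntK].
    by rewrite astabsJ => nKA; apply: minP; rewrite ntK.
  have:= pcore_sub_astab_irr pM (subsetT M) irrA.
  rewrite astabJ subsetI => /andP[_ cMAp].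
  have [_ <- _ _] := dprodP (nilpotent_pcoreC p nilA).
  by rewrite mul_subG // centsC.
(* The commutator of [M :&: N] with the [p']-core lies in [M :&: A = 1]; minimality of [M] then
   leaves only the case excluded by [cMN]. *)
have tiMN: M :&: N = 1.
  have cMNI: M :&: N \subset 'C_M('O_p^'(A)).
    rewrite subsetI subsetIl /=; apply/commG1P/trivgP; rewrite -tiMA.
    have sOA := pcore_sub p^' A; rewrite subsetI.
    rewrite (subset_trans (commSg _ (subsetIl M N))) ?commg_subl /=; last first.
      exact: subset_trans sOA nMA.
    apply: subset_trans sOA; rewrite commg_subr.
    by rewrite (subset_trans (subsetIr _ _)) ?subsetIr.
  apply/eqP/idPn=> ntMN; apply: cMN; apply: (minP 'C_M('O_p^'(A))%G).
    rewrite (subG1_contra cMNI) //= normsI ?norms_cent //.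
    exact: gFnorm.
  exact: subsetIl.
have defN: N = A.
  by rewrite -[RHS]mul1g -tiMN setIC group_modr // -defQ (setIidPl (subsetIl _ _)).
exists m => //; apply/eqP; rewrite eq_sym eqEcard cardJg oAL leqnn andbT.
by rewrite -defN.
Qed.

End Complements.

(** * Orbits of normal subgroups as blocks, and the descent *)

Section Blocks.

Variables (gT : finGroupType) (D : {group gT}) (T : finType).
Variable to : action D T.
Implicit Types X Y A : {group gT}.

Lemma mem_astab1_in t u : u \in D -> (u \in 'C[t | to]) = (to t u == t).
Proof. by move=> Du; rewrite !inE Du sub1set inE. Qed.

Lemma mem_orbit_norm Y s t u :
    Y \subset D -> u \in D -> u \in 'N(Y) ->
  (to s u \in orbit to Y (to t u)) = (s \in orbit to Y t).
Proof. by move=> sYD Du nYu; rewrite -{1}(normP nYu) orbit_conjsg_in. Qed.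

Lemma setact_orbit_norm Y t u :
    Y \subset D -> u \in D -> u \in 'N(Y) ->
  (to^* (orbit to Y t) u)%act = orbit to Y (to t u).
Proof.
move=> sYD Du nYu; apply/setP=> s; rewrite -(actKVin to Du s).
by rewrite mem_orbit_norm //; apply: (mem_imset _ _ (@act_inj _ _ _ to u)).
Qed.

Lemma mem_astabs_orbit Y t u :
    Y \subset D -> u \in D -> u \in 'N(Y) ->
  (u \in 'N(orbit to Y t | to)) = (to t u \in orbit to Y t).
Proof.
move=> sYD Du nYu; apply/idP/idP=> [nSu | Stu].
  by rewrite (astabs_act _ nSu) orbit_refl.
rewrite !inE Du; apply/subsetP=> s Ss; rewrite inE.
by rewrite -(orbit_in_eqP sYD Stu) mem_orbit_norm.
Qed.

Lemma sub_astab1_act X Y t x :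
    X \subset D -> Y <| X -> x \in X -> 'C_X[t | to] \subset Y ->
  'C_X[to t x | to] \subset Y.
Proof.
move=> sXD nsYX Xx sCY; have [sYX nYX] := andP nsYX.
rewrite astab1_act_in ?(subsetP sXD) //.
by rewrite -{1}(conjGid Xx) -conjIg -(normsP nYX x Xx) conjSg.
Qed.

(** If [x] sends [t] to its image under [y] in [Y], then [x * y^-1] fixes [t], hence lies in [Y]. *)
Lemma astabs_regular_block X Y t :
    X \subset D -> Y <| X -> 'C_X[t | to] \subset Y ->
  X :&: 'N(orbit to Y t | to) = Y.
Proof.
move=> sXD nsYX sCY; have [sYX nYX] := andP nsYX.
have sYD := subset_trans sYX sXD.
apply/eqP; rewrite eqEsubset subsetI sYX acts_orbit // !andbT.
apply/subsetP=> x /setIP[Xx].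
rewrite mem_astabs_orbit ?(subsetP sXD) ?(subsetP nYX) //.
case/imsetP=> y Yy Dtx; have Xy := subsetP sYX y Yy.
rewrite -(mulgKV y x) groupM // (subsetP sCY) // inE groupM ?groupV //=.
rewrite mem_astab1_in ?groupM ?groupV ?(subsetP sXD) //.
by rewrite actMin ?groupV ?(subsetP sXD) // Dtx (actKin to) ?(subsetP sYD).
Qed.

Lemma exists_block_kernel G X Y A t :
    acts_with_regular_orbits A G -> nilpotent A -> A \subset D ->
    solvable X -> X \subset G -> X \subset D -> A \subset 'N(X) ->
    X :&: A = 1 -> Y <| X -> A \subset 'N(Y) ->
    minnormal (X / Y) (A / Y) -> 'C_X[t | to] \subset Y ->
    {in A, forall a, to t a \in orbit to X t} ->
  exists2 s, s \in orbit to X t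
           & [~: X, 'N_A(orbit to Y s | to)] \subset Y.
Proof.
move=> regA nilA sAD solX sXG sXD nXA tiXA nsYX nYA minXY sCY XtA.
have [sYX nYX] := andP nsYX; have sYD := subset_trans sYX sXD.
have [cXYA | ncXYA] := boolP ([~: X, A] \subset Y).
  exists t; first exact: orbit_refl.
  by rewrite (subset_trans _ cXYA) ?commgS ?subsetIl.
have [t1 Xt1 nt1A]: exists2 t1, t1 \in orbit to X t &
    A \subset 'N(orbit to Y t1 | to).
  pose Q := (X <*> A)%G; have defQ: Q :=: X * A by rewrite /= norm_joinEr.
  have sQD: Q \subset D by rewrite join_subG sXD.
  have nYQ: Q \subset 'N(Y) by rewrite join_subG nYX.
  (* A Frattini argument: [A] keeps [t] in its [X]-orbit, so [X * L = X * A], and [L / Y] and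
     [A / Y] are both complements to [X / Y]. Conjugating one to the other moves the block of [t] to
     one fixed by [A]. *)
  pose L := 'N_Q(orbit to Y t | to)%G.
  have sYL: Y \subset L.
    by rewrite subsetI acts_orbit // andbT (subset_trans sYX) ?joing_subl.
  have tiXL: X :&: L = Y.
    by rewrite setIA (setIidPl (joing_subl _ _)) astabs_regular_block.
  have eqXAL: X * A = X * L.
    rewrite -defQ; apply/eqP; rewrite eqEsubset andbC.
    rewrite mul_subG ?joing_subl ?subsetIl //=.
    have nXL: L \subset 'N(X).
      by apply: subset_trans (subsetIl _ _) _; rewrite join_subG normG.
    rewrite -norm_joinEr // join_subG joing_subl; apply/subsetP=> a Aa.
    have /imsetP[x Xx Dta] := XtA a Aa; have Dx := subsetP sXD x Xx.
    have Qax: a * x^-1 \in Q by rewrite groupM ?mem_gen // inE ?Aa ?groupV ?Xx ?orbT.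
    rewrite -(mulgKV x a) groupMr ?mem_gen // inE ?Xx //; apply/orP; right.
    rewrite inE Qax.
    rewrite mem_astabs_orbit ?(subsetP sQD) ?(subsetP nYQ) //.
    have Da := subsetP sAD a Aa.
    by rewrite actMin ?groupV // Dta (actKin to) // orbit_refl.
  have [||||x' /morphimP[x nYx Xx ->] defAY] :=
    minnormal_complement_conj (L := (L / Y)%G) minXY (quotient_sol _ solX)
      (quotient_nil _ nilA).
  - by rewrite quotient_cents2 // commGC.
  - by rewrite -quotientGI // tiXA quotient1.
  - by rewrite -quotientGI // tiXL trivg_quotient.
  - by rewrite -!quotientMl // eqXAL.
  have Dx := subsetP sXD x Xx.
  have sALx: A \subset L :^ x.
    rewrite -(quotientSGK nYA) ?quotientJ ?defAY //.
    by rewrite -(normP nYx) conjSg.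
  exists (to t x); first exact: mem_orbit.
  apply/subsetP=> a Aa; rewrite mem_astabs_orbit ?(subsetP sAD) ?(subsetP nYA) //.
  have /imsetP[l /setIP[Ql ntl] ->] := subsetP sALx a Aa.
  have Dl := subsetP sQD l Ql.
  rewrite -actMin ?groupJ // -conjgC actMin // mem_orbit_norm //.
  by rewrite -mem_astabs_orbit // (subsetP nYQ).
have /imsetP[x0 Xx0 Dt1] := Xt1.
have sC1Y: 'C_X[t1 | to] \subset Y by rewrite Dt1 sub_astab1_act.
have irrXY: acts_irreducibly A (X / Y) 'Q by rewrite acts_irrQ.
have [_ /morphimP[x nYx Xx ->] regx] := regA X Y sXG nsYX nXA nYA irrXY.
have Dx := subsetP sXD x Xx.
(* Let [b] in [A] stabilise the block of [to t1 x], and let [y] in [Y] act on [t1] as [b] does. Then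
   [y * x ^ b * x^-1] stabilises the block of [t1], so lies in [Y]. Thus [b] fixes the coset of [x],
   which was chosen so that [b] then centralises [X / Y]. *)
exists (to t1 x); first by rewrite Dt1 -actMin ?(subsetP sXD) ?mem_orbit ?groupM.
rewrite commGC -sub_astabQR //; last by rewrite subIset ?nYA.
suffices: 'N_A(orbit to Y (to t1 x) | to) \subset 'C_A(X / Y | 'Q).
  by rewrite subsetI => /andP[].
rewrite -regx; apply/subsetP=> b /setIP[Ab nb]; rewrite inE Ab /=.
have [Db nYb] := (subsetP sAD b Ab, subsetP nYA b Ab).
have /imsetP[y Yy Dt1b]: to t1 b \in orbit to Y t1.
  by rewrite -mem_astabs_orbit // (subsetP nt1A).
have Xxb: x ^ b \in X by rewrite memJ_norm ?(subsetP nXA).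
have Xy := subsetP sYX y Yy.
have Xz: y * x ^ b * x^-1 \in X by rewrite groupMr ?groupV // groupMl.
have [[Dz Dy] Dxb] := (subsetP sXD _ Xz, subsetP sXD _ Xy, subsetP sXD _ Xxb).
have: y * x ^ b * x^-1 \in Y.
  rewrite -(astabs_regular_block sXD nsYX sC1Y) in_setI Xz /=.
  rewrite mem_astabs_orbit ?(subsetP nYX) //.
  rewrite -(mem_orbit_norm _ _ sYD Dx nYx) -actMin //.
  rewrite mulgKV actMin // -Dt1b -actMin //.
  by rewrite -conjgC actMin // -mem_astabs_orbit.
rewrite -mulgA groupMl // => Yxbx.
rewrite astabQ mem_morphpre //= cent_set1; apply/cent1P.
rewrite /commute [RHS]conjgC -morphJ //.
by rewrite -[x ^ b](mulgKV x) /= coset_kerl.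
Qed.

Lemma orbit_norm_disjoint Y t u :
    Y \subset D -> u \in D -> u \in 'N(Y) -> u \notin 'N(orbit to Y t | to) ->
  [disjoint orbit to Y t & (to^* (orbit to Y t) u)%act].
Proof.
move=> sYD Du nYu; rewrite mem_astabs_orbit // setact_orbit_norm //.
apply: contraNT => /pred0Pn[s /andP[/= Yts Ytus]].
rewrite (orbit_in_sym to sYD) in Ytus.
exact: (orbit_in_trans sYD Ytus Yts).
Qed.

(* X is a subgroup such that the orbit of s under X is fixed by A and its     *)
(* C_G(A)-translates cover T; such an X can be shrunk until it is trivial.    *)
Lemma astab_of_block_kernels G A :
    good_action A G -> acts_with_regular_orbits A G ->
    solvable G -> nilpotent A -> G \subset D -> A \subset D ->
    A \subset 'N(G) -> G :&: A = 1 -> [transitive G, on [set: T] | to] ->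
    (forall Y s (B := 'N_A(orbit to Y s | to)), Y \subset G -> A \subset 'N(Y) ->
      (forall t, exists2 c, c \in 'C_G(B) & t \in (to^* (orbit to Y s) c)%act) ->
      A \subset 'N(orbit to Y s | to)) ->
  A \subset 'C([set: T] | to).
Proof.
move=> goodA regA solG nilA sGD sAD nGA tiGA trG kerA.
have [s0 _ Gs0] := imsetP trG.
suffices IH X s : X \subset G -> A \subset 'N(X) ->
    {in A, forall a, to s a \in orbit to X s} ->
    (forall t, exists2 c, c \in 'C_G(A) & t \in (to^* (orbit to X s) c)%act) ->
  A \subset 'C([set: T] | to).
- apply: (IH G s0) => // [a _ | t]; rewrite -Gs0 ?inE //.
  by exists 1; rewrite ?group1 // act1 inE.
move: {2}_.+1 (ltnSn #|X|) => m; elim: m => // m IH in X s *.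
rewrite ltnS => leXm sXG nXA XsA cover.
have sXD := subset_trans sXG sGD; have solX := solvableS sXG solG.
(* Here [A] fixes [s], hence also all its ['C_G(A)]-translates, which are all the points. *)
have [X1 | ntX] := eqVneq X 1%G.
  have orbX t: t \in orbit to X s -> t = s.
    by case/imsetP=> x; rewrite X1 => /set1P-> ->; rewrite act1.
  apply/subsetP=> a Aa; have Da := subsetP sAD a Aa.
  rewrite !inE Da; apply/subsetP=> t _; rewrite inE.
  have [c /setIP[Gc cAc] /imsetP[_ /orbX-> ->]] := cover t.
  have Dc := subsetP sGD c Gc.
  by rewrite -actMin // (centP cAc) // actMin // (orbX _ (XsA a Aa)).
have [Y maxY sX'Y]: {Y : {group gT} | maxnormal Y X A & X^`(1) \subset Y}.
  apply: maxgroup_exists; rewrite (sol_der1_proper solX) //=.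
  by rewrite (char_norm_trans (der_char 1 X)).
have /andP[ltYX nYA] := maxgroupp maxY; have sYX := proper_sub ltYX.
have nsYX: Y <| X := sub_der1_normal sX'Y sYX.
have [sYG sYD] := (subset_trans sYX sXG, subset_trans sYX sXD).
have ltYm: #|Y| < m := leq_trans (proper_card ltYX) leXm.
have nYX := normal_norm nsYX.
(* [K] contains [X'], so is normal in [X]; since [A] conjugates the stabiliser of [s] as elements of
   [X] do, [K] is [A]-invariant. By maximality of [Y], [K] is [X] (same orbit) or [Y] (regular
   action of [X / Y] on blocks). *)
pose K := (Y <*> 'C_X[s | to])%G.
have sKX: K \subset X by rewrite join_subG sYX subsetIl.
have nKA: A \subset 'N(K).
  apply/subsetP=> a Aa; rewrite inE /= conjYg join_subG.
  rewrite (normsP nYA) // joing_subl conjIg (normsP nXA) //.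
  rewrite -astab1_act_in ?(subsetP sAD) //.
  have /imsetP[x Xx ->] := XsA a Aa.
  rewrite astab1_act_in ?(subsetP sXD) // -{1}(conjGid Xx) -conjIg.
  have nKX: X \subset 'N(K).
    apply/normal_norm/sub_der1_normal => //.
    exact: subset_trans (joing_subl _ _).
  by rewrite -(normsP nKX x Xx) conjSg joing_subr.
have [eqKX | neqKX] := eqVneq (K : {set gT}) X.
  have eqYX: orbit to X s = orbit to Y s.
    apply/eqP; rewrite eqEsubset andbC imsetS //=.
    have nYC: 'C_X[s | to] \subset 'N(Y) by rewrite subIset ?nYX.
    apply/subsetP=> _ /imsetP[x Xx ->]; move: Xx.
    rewrite -eqKX /= norm_joinEr // -normC // => /mulsgP[c y /setIP[Xc cc] Yy ->].
    have [Dc Dy] := (subsetP sXD c Xc, subsetP sYD y Yy).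
    by rewrite mem_astab1_in // in cc; rewrite actMin // (eqP cc) mem_orbit.
  by apply: (IH Y s) => // [a Aa | t]; rewrite -eqYX ?XsA.
have defK: K :=: Y.
  by apply: (maxgroupP maxY).2; rewrite ?joing_subl // properEneq neqKX sKX.
have sCY: 'C_X[s | to] \subset Y by rewrite -defK joing_subr.
have minXY: minnormal (X / Y) (A / Y) by apply: maxnormal_minnormal.
have tiXA: X :&: A = 1 by apply/trivgP; rewrite -tiGA setSI.
have [s1 Xs1] := exists_block_kernel regA nilA sAD solX sXG sXD nXA tiXA
                   nsYX nYA minXY sCY XsA.
set B := 'N_A(_ | _) => sXBY.
(* Goodness writes an element of [X] as a product of one in [[~: X, B]], absorbed by [Y], and one in
   ['C_X(B)], absorbed into the translating element. *)
have coverB t: exists2 c, c \in 'C_G(B) & t \in (to^* (orbit to Y s1) c)%act.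
  have [c /setIP[Gc cAc]] := cover t.
  rewrite -(orbit_in_eqP sXD Xs1) => /imsetP[_ /imsetP[x Xx ->] ->].
  have sBA: B \subset A := subsetIl _ _.
  have nXB := subset_trans sBA nXA.
  have: x \in X by []. 
  rewrite -{1}(goodA [group of B] X sBA sXG nXB) => /mulsgP[y d XBy /setIP[Xd cBd] ->].
  exists (d * c).
    by rewrite inE groupM ?(subsetP sXG d) //= groupM // (subsetP (centS sBA)).
  have Yy := subsetP sXBY y XBy.
  have [Dd Dc] := (subsetP sXD d Xd, subsetP sGD c Gc).
  rewrite (actMin to _ (subsetP sYD y Yy) Dd) -(actMin to _ Dd Dc).
  exact: (mem_setact to (d * c) (mem_orbit to s1 Yy)).
have sAB := kerA Y s1 sYG nYA coverB.
apply: (IH Y s1) => // [a Aa | ].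
  by rewrite -mem_astabs_orbit ?(subsetP sAB) ?(subsetP sAD) ?(subsetP nYA).
by rewrite /B (setIidPl sAB) in coverB.
Qed.

End Blocks.

(** * Clifford theory for a homogeneous, possibly reducible, module *)

Section HomogeneousClifford.

Import GRing.Theory.
Local Open Scope ring_scope.

Variables (F : fieldType) (gT : finGroupType) (L G H : {group gT}).
Variables (nsHL : H <| L) (sGL : G \subset L) (sHG : H \subset G).
Variables (n : nat) (rL : mx_representation F L n).

Local Notation rG := (subg_repr rL sGL).
Local Notation rH := (subg_repr rL (normal_sub nsHL)).

Lemma mx_iso_subg_repr (U M f : 'M[F]_n) :
    (U <= dom_hom_mx rG f)%MS -> f \in unitmx -> (M <= U)%MS ->
  mx_iso rH M (M *m f).
Proof.
move=> homUf injf sMU; exists f => //.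
apply: submx_trans sMU _; apply/hom_mxP=> x Hx.
exact: (hom_mxP homUf) (subsetP sHG x Hx).
Qed.

Lemma homogeneous_mx_iso (S S' : 'M_n) :
  homogeneous_repr rG -> mxsimple rG S -> mxsimple rG S' -> mx_iso rG S S'.
Proof.
case=> I [U []] simU isoU defU _ simS simS'.
have iso_sub S0 : mxsimple rG S0 -> {i | mx_iso rG (U i) S0}.
  move=> simS0; have [|i _ isoUS0] := hom_mxsemisimple_iso (f := 1%:M) simS0
    (fun i (_ : true) _ => simU i) (scalar_mx_hom _ _ _).
    by rewrite mulmx1 defU submx1.
  by exists i.
have [[i isoUS] [j isoUS']] := (iso_sub S simS, iso_sub S' simS').
exact: mx_iso_trans (mx_iso_sym isoUS) (mx_iso_trans (isoU i j) isoUS').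
Qed.

(** The [G]-translates of [M'] span a [G]-module, which contains a copy of [U] by homogeneity, hence
    one of [M]; a simple submodule of a sum of simple modules is isomorphic to a summand. Simple
    submodules exist only classically over a general field. *)
Lemma mx_iso_translate (U M M' : 'M_n) :
    homogeneous_repr rG -> mxsimple rG U -> mxsimple rH M -> (M <= U)%MS ->
    mxsimple rH M' ->
  classically (exists2 x, x \in G & mx_iso rH (M' *m rL x) M).
Proof.
move=> homG simU simM sMU simM'.
pose S := (\sum_(x in G) M' *m rL x)%MS.
have modS: mxmodule rG S.
  apply/mxmoduleP=> x Gx; rewrite sumsmxMr; apply/sumsmx_subP=> y Gy.
  by rewrite (sumsmx_sup (y * x)%g) ?groupM // -mulmxA repr_mxM ?(subsetP sGL).
have nzS: S != 0.
  have [_ nzM' _] := simM'; apply: contraNneq nzM' => S0.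
  by rewrite -submx0 -S0 (sumsmx_sup 1%g) ?repr_mx1 ?mulmx1.
move=> b isoMb; apply: (mxsimple_exists modS nzS) => [[S0 simS0 sS0S]].
have [f injf homUf defS0] := homogeneous_mx_iso homG simU simS0.
have isoMf := mx_iso_subg_repr homUf injf sMU.
have [x|||x Gx isoM'] := hom_mxsemisimple_iso (f := 1%:M) (P := mem G)
   (W := fun x => M' *m rL x) (mx_iso_simple isoMf simM).
- by move=> Gx _; apply: Clifford_simple; rewrite ?(subsetP sGL).
- exact: scalar_mx_hom.
- by rewrite mulmx1 (submx_trans _ sS0S) // -defS0 submxMr.
by apply: isoMb; exists x; last exact: mx_iso_trans isoM' (mx_iso_sym isoMf).
Qed.

(** Both components have translates of the type of one simple [M], so one translation followed by
    the inverse of the other carries [W] to [W']. *)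
Lemma Clifford_orbit_homogeneous (sH : socleType rH) (W W' : sH) :
  homogeneous_repr rG -> W' \in orbit (Clifford_action sH) G W.
Proof.
move=> homG; have [simW simW'] := (socle_simple W, socle_simple W').
have nz1: (1%:M : 'M[F]_n) != 0.
  by apply: contraNneq (nz_socle W) => n0; rewrite -[W : 'M_n]mulmx1 n0 mulmx0.
apply: (mxsimple_exists (mxmodule1 rG) nz1) => [[U simU _]].
have [modU0 nzU _] := simU.
have modHU: mxmodule rH U.
  by apply/mxmoduleP=> x Hx; apply: (mxmoduleP modU0); apply: (subsetP sHG).
apply: (mxsimple_exists modHU nzU) => [[M simM sMU]].
apply: (mx_iso_translate homG simU simM sMU simW) => [[x Gx isoWM]].
apply: (mx_iso_translate homG simU simM sMU simW') => [[y Gy isoW'M]].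
have [Lx Ly] := (subsetP sGL x Gx, subsetP sGL y Gy).
apply/imsetP; exists (x * y^-1)%g; first by rewrite groupM ?groupV.
have isoWW': mx_iso rH (socle_base W *m rL (x * y^-1)%g) (socle_base W').
  rewrite -[socle_base W'](repr_mxK rL Ly) repr_mxM ?groupV // mulmxA.
  apply: Clifford_iso2 (groupVr Ly) => //.
  exact: mx_iso_trans isoWM (mx_iso_sym isoW'M).
have Lxy: (x * y^-1)%g \in L by rewrite groupM ?groupV.
apply/socleP/eqmxP/eqmx_sym; apply: eqmx_trans (val_Clifford_act _ Lxy) _.
apply: eqmx_trans (eqmx_sym (Clifford_componentJ simW Lxy)) _.
apply/eqmxP; rewrite (sameP genmxP eqP) !genmx_component.
by apply/component_mx_isoP => //; apply: Clifford_simple.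
Qed.

End HomogeneousClifford.

Theorem theorem3p3 (gT : finGroupType) (G A GA : {group gT})
    (defGA : G ><| A = GA)
    (solG : solvable G) (nilA : nilpotent A)
    (regA : acts_with_regular_orbits A G) (goodA : good_action A G)
    (R : realType) (n : nat) (rV : mx_representation (complex R) GA n)
    (homVG : homogeneous_repr (subg_repr rV (sdprod_subl defGA)))
    (CVA : rfix_mx rV A = 0%R)
    (CVA0 : forall A0 : {group gT}, A0 \proper A -> rfix_mx rV A0 != 0%R)
    (N : {group gT}) (sNG : N \subset G) (nsN : N <| GA)
    (ntZN : ~~ ([~: 'Z(N), A] \subset rker rV))
    (W : 'M[complex R]_n)
    (compW : homogeneous_component (subg_repr rV (normal_sub nsN)) W) :
  [/\ A \subset rstabs rV W,
      [~: G, A] \subset G :&: rstabs rV W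
    & G :=: (G :&: rstabs rV W) * 'C_G(A)].
Proof.
have [sGGA sAGA] : G \subset GA /\ A \subset GA.
  by have [/normal_sub] := sdprod_context defGA.
have [_ _ _ nGA tiGA] := sdprod_context defGA.
have F'gr (H : {group gT}) : ([pchar (complex R)]^'.-group H)%R.
  by apply: sub_pgroup (pgroup_pi H) => p _; rewrite inE /= Num.Theory.pchar_num.
have eqG : [~: G, A] * 'C_G(A) = G by apply: goodA.
suffices sARW : A \subset rstabs rV W /\ [~: G, A] \subset rstabs rV W.
  have [sAW sGAW] := sARW; have sGAG : [~: G, A] \subset G by rewrite commg_subl.
  split=> //; first by rewrite subsetI sGAG.
  apply/eqP; rewrite eqEsubset mul_subG ?subsetIl // andbT -{1}eqG.
  by rewrite mulSg // subsetI sGAG.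
(* The goal is made boolean because [socle_exists] is a classical statement. *)
apply/andP; pose rN := subg_repr rV (normal_sub nsN).
apply: (@socle_exists _ _ _ _ rN) => [sN].
have [M simM defW] := compW.
pose W0 := PackSocle (component_socle sN simM).
have eqW : rstabs rV W = 'C[W0 | Clifford_action sN].
  rewrite Clifford_astab1; apply: eqmx_rstabs.
  by apply: eqmx_trans defW _; rewrite PackSocleK.
set to := Clifford_action sN in eqW.
have trG : [transitive G, on [set: sN] | to].
  apply/imsetP; exists W0; rewrite ?inE //; apply/esym/setP=> W1.
  by rewrite inE (Clifford_orbit_homogeneous sNG W0 W1 homVG).
have sum1 : (\sum_(W1 : sN) W1 :=: (1%:M)%R)%MS.
  by rewrite -/(Socle sN) reducible_Socle1 //; apply: mx_Maschke_pchar.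
have cAT : A \subset 'C([set: sN] | to).
  apply: (astab_of_block_kernels goodA) => // Y t B sYG nYA coverB.
  have sBA : B \subset A := subsetIl _ _.
  have sYGA := subset_trans sYG sGGA.
  have fixB0 : rfix_mx rV B = 0%R.
    apply: (rfix0_of_block sum1 (Socle_direct sN) (val_Clifford_act (sH := sN)))
      => [|| t'].
    - exact: subset_trans sBA sAGA.
    - apply: (block_rfix0 sum1 (Socle_direct sN)
        (val_Clifford_act (sH := sN)) (F'gr _) sAGA sBA _ _ CVA) => [b Bb | a Aa].
        by have [_ nSb] := setIP Bb; apply: astabs_setact nSb.
      rewrite inE Aa /= => nSa; have GAa := subsetP sAGA a Aa.
      by apply: orbit_norm_disjoint; rewrite ?(subsetP nYA).
    have [c cBc Yc] := coverB t'; exists c => //.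
    by apply: subsetP cBc; rewrite setSI.
  have [/CVA0/eqP// | ] := boolP (B \proper A).
  by rewrite properE sBA negbK => /subset_trans-> //; apply: subsetIr.
(* The kernel of the action on components is normalised by [G] and contains [A], so it contains
   [[~: G, A]]. *)
have nCG : G \subset 'N('C([set: sN] | to)).
  apply: subset_trans (astab_norm _ _); apply/subsetP=> x Gx.
  by rewrite !inE (subsetP sGGA) //; apply/subsetP=> t _; rewrite inE.
rewrite !eqW; have sCW := astabS to (subsetT [set W0]).
rewrite (subset_trans cAT sCW) (subset_trans _ sCW) //.
by apply: subset_trans (commgS G cAT) _; rewrite commg_subr.
Qed.
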